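(* Let $B(t,x;231,321)=\sum_{n=0}^{\infty}\sum_{\pi\in\mathfrak{S}_n(231,321)}t^{\mathrm{bdes}(\pi)}x^n$. Then $$B(t,x;231,321)=\frac{1-x}{1-2x+(1-t)x^{3}}.$$
   Context: $\mathfrak{S}_n$ is the set of permutations $\pi=\pi_1\pi_2\cdots\pi_n$ of $[n]=\{1,\dots,n\}$ in one-line notation ($\mathfrak{S}_0$ consists of the empty permutation). $\mathfrak{S}_n(231,321)$ is the set of $\pi\in\mathfrak{S}_n$ having no length-three subsequence with the same relative order as $231$ or as $321$. An index $k\in[n-1]$ is a big descent of $\pi\in\mathfrak{S}_n$ if $\pi_k>\pi_{k+1}+1$; $\mathrm{bdes}(\pi)$ is the number of big descents of $\pi$. The identity is one of formal power series in $x$ with coefficients polynomials in $t$. *)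

(* Defs.v *)
From HB Require Import structures.
From mathcomp Require Import all_boot all_order all_algebra all_fingroup.
From mathcomp Require Import boolp.

Set Implicit Arguments.
Unset Strict Implicit.
Unset Printing Implicit Defensive.

Import GRing.Theory.
Local Open Scope ring_scope.

(* Formal power series in one variable. A record rather than [nat -> R],
   because function types already carry a pointwise ring structure. *)
Record fps (R : Type) := Fps { fcoef : nat -> R }.

HB.instance Definition _ (R : Type) := gen_eqMixin (fps R).
HB.instance Definition _ (R : Type) := gen_choiceMixin (fps R).

Lemma fpsP (R : Type) (f g : fps R) : (forall n, fcoef f n = fcoef g n) <-> f = g.
Proof.
split=> [|-> //]; case: f g => [f] [g] /= fg.
by congr Fps; apply/funext.
Qed.

Section FpsZmod.
Variable R : zmodType.
Implicit Types f g h : fps R.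

Definition fps_zero : fps R := Fps (fun=> 0).
Definition fps_opp f := Fps (fun n => - fcoef f n).
Definition fps_add f g := Fps (fun n => fcoef f n + fcoef g n).

Fact fps_addA : associative fps_add.
Proof. by move=> f g h; apply/fpsP => n /=; rewrite addrA. Qed.
Fact fps_addC : commutative fps_add.
Proof. by move=> f g; apply/fpsP => n /=; rewrite addrC. Qed.
Fact fps_add0 : left_id fps_zero fps_add.
Proof. by move=> f; apply/fpsP => n /=; rewrite add0r. Qed.
Fact fps_addN : left_inverse fps_zero fps_opp fps_add.
Proof. by move=> f; apply/fpsP => n /=; rewrite addNr. Qed.

HB.instance Definition _ :=
  GRing.isZmodule.Build (fps R) fps_addA fps_addC fps_add0 fps_addN.

End FpsZmod.

Section FpsRing.
Variable R : comNzRingType.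
Implicit Types f g h : fps R.

Definition fpsC (c : R) : fps R := Fps (fun n => if n == 0%N then c else 0).
Definition fpsX : fps R := Fps (fun n => (n == 1%N)%:R).

Definition fps_mul f g :=
  Fps (fun n => \sum_(i < n.+1) fcoef f i * fcoef g (n - i)).

Definition fps_trunc n f : {poly R} := \poly_(i < n.+1) fcoef f i.

Fact coef_fps_trunc n f i : (i <= n)%N -> (fps_trunc n f)`_i = fcoef f i.
Proof. by move=> le_in; rewrite coef_poly ltnS le_in. Qed.

Fact fps_mul_coef m n f g (p q : {poly R}) :
    (m <= n)%N ->
    (forall i, (i <= n)%N -> p`_i = fcoef f i) ->
    (forall i, (i <= n)%N -> q`_i = fcoef g i) ->
  fcoef (fps_mul f g) m = (p * q)`_m.
Proof.
move=> le_mn pf qg; rewrite coefM /=; apply: eq_bigr => i _.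
by rewrite pf ?qg ?(leq_trans _ le_mn) ?leq_subr // -ltnS.
Qed.

Fact fps_mulC : commutative fps_mul.
Proof.
move=> f g; apply/fpsP => n.
have cf h i : (i <= n)%N -> (fps_trunc n h)`_i = fcoef h i.
  exact: coef_fps_trunc.
by rewrite !(fps_mul_coef (leqnn n) (cf _) (cf _)) mulrC.
Qed.

Fact fps_mulA : associative fps_mul.
Proof.
move=> f g h; apply/fpsP => n.
have cf k i : (i <= n)%N -> (fps_trunc n k)`_i = fcoef k i.
  exact: coef_fps_trunc.
have cfM k l i : (i <= n)%N ->
    (fps_trunc n k * fps_trunc n l)`_i = fcoef (fps_mul k l) i.
  by move=> le_in; rewrite (fps_mul_coef le_in (cf _) (cf _)).
rewrite (fps_mul_coef (leqnn n) (cf _) (cfM _ _)).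
by rewrite (fps_mul_coef (leqnn n) (cfM _ _) (cf _)) mulrA.
Qed.

Fact fps_mul1 : left_id (fpsC 1) fps_mul.
Proof.
move=> f; apply/fpsP => n /=; rewrite big_ord_recl /= subn0 mul1r.
by rewrite big1 ?addr0 // => i _; rewrite mul0r.
Qed.

Fact fps_mulDl : left_distributive fps_mul +%R.
Proof.
move=> f g h; apply/fpsP => n /=; rewrite -big_split /=.
by apply: eq_bigr => i _; rewrite mulrDl.
Qed.

Fact fps_oner_neq0 : fpsC 1 != 0.
Proof.
apply/eqP => /fpsP/(_ 0%N) /= /eqP.
by rewrite oner_eq0.
Qed.

HB.instance Definition _ := GRing.Zmodule_isComNzRing.Build (fps R)
  fps_mulA fps_mulC fps_mul1 fps_mulDl fps_oner_neq0.

Lemma fcoefM f g n :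
  fcoef (f * g) n = \sum_(i < n.+1) fcoef f i * fcoef g (n - i).
Proof. by []. Qed.

Lemma fcoef1 n : fcoef (1 : fps R) n = (n == 0%N)%:R.
Proof. by case: n. Qed.

End FpsRing.

Section FpsUnitRing.
Variable R : comUnitRingType.
Implicit Types f g : fps R.

Definition fps_unit : {pred fps R} := fun f => fcoef f 0 \is a GRing.unit.

(* The first n coefficients of 1 / f, from solving
   f_0 g_m + f_1 g_(m-1) + ... + f_m g_0 = [m = 0] for g_m. *)
Fixpoint fps_inv_seq f n : seq R :=
  if n is m.+1 then
    let s := fps_inv_seq f m in
    rcons s ((fcoef f 0)^-1 *
             ((m == 0%N)%:R - \sum_(i < m) fcoef f i.+1 * s`_(m - i.+1)))
  else [::].

Definition fps_inv f : fps R :=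
  if f \in fps_unit then Fps (fun n => (fps_inv_seq f n.+1)`_n) else f.

Fact size_fps_inv_seq f n : size (fps_inv_seq f n) = n.
Proof. by elim: n => //= n IHn; rewrite size_rcons IHn. Qed.

Fact nth_fps_inv_seq f n i :
  (i < n)%N -> (fps_inv_seq f n)`_i = (fps_inv_seq f i.+1)`_i.
Proof.
elim: n => // n IHn; rewrite ltnS leq_eqVlt => /orP[/eqP-> //|lt_in].
by rewrite -(IHn lt_in) /= nth_rcons size_fps_inv_seq lt_in.
Qed.

Fact fps_mulVr : {in fps_unit, left_inverse 1 fps_inv *%R}.
Proof.
move=> f Uf; rewrite mulrC; apply/fpsP => n; rewrite fcoef1 fcoefM /fps_inv Uf.
rewrite big_ord_recl subn0 [X in _ * X + _]/= nth_rcons size_fps_inv_seq.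
rewrite ltnn eqxx mulrA divrr // mul1r -addrA -[RHS]addr0; congr (_ + _).
apply/eqP; rewrite addrC subr_eq0; apply/eqP; apply: eq_bigr => i _.
rewrite lift0; congr (_ * _).
by rewrite [RHS]nth_fps_inv_seq // subnSK // leq_subr.
Qed.

Fact fps_unitPl f g : g * f = 1 -> fps_unit f.
Proof.
move/fpsP/(_ 0%N); rewrite fcoefM big_ord1 subn0 fcoef1 /= => gf1.
by apply/unitrPr; exists (fcoef g 0); rewrite mulrC.
Qed.

Fact fps_inv_out : {in [predC fps_unit], fps_inv =1 id}.
Proof. by move=> f; rewrite inE /fps_inv => /negPf ->. Qed.

HB.instance Definition _ := GRing.ComNzRing_hasMulInverse.Build (fps R)
  fps_mulVr fps_unitPl fps_inv_out.

Lemma fps_unitE f : (f \is a GRing.unit) = (fcoef f 0 \is a GRing.unit).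
Proof. by []. Qed.

End FpsUnitRing.

(* Permutations of [n] are elements of 'S_n = {perm 'I_n}: positions and values
   are numbered from 0 instead of 1, which changes neither relative order nor
   differences of values. A pattern is its one-line word, e.g. [:: 2; 3; 1]. *)
Definition contains n (s : 'S_n) (p : seq nat) : bool :=
  [exists f : {ffun 'I_(size p) -> 'I_n},
    [forall i : 'I_(size p), forall j : 'I_(size p),
      ((i < j)%N ==> (f i < f j)%N) &&
      ((s (f i) < s (f j))%N == (nth 0%N p i < nth 0%N p j)%N)]].

Definition avoiders n (ps : seq (seq nat)) : {set 'S_n} :=
  [set s : 'S_n | all (fun p => ~~ contains s p) ps].

Definition big_descent n (s : 'S_n) (k : 'I_n) : bool :=
  [exists l : 'I_n, (l == k.+1 :> nat) && (s l + 1 < s k)%N].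

Definition bdes n (s : 'S_n) : nat := #|[set k : 'I_n | big_descent s k]|.

(* The indeterminate t is 'X : {poly int}; the indeterminate x is fpsX. *)
Definition bdes_gf (ps : seq (seq nat)) : fps {poly int} :=
  Fps (fun n => \sum_(s in avoiders n ps) 'X^(bdes s)).

(* Main.v *)
(* In a permutation avoiding 231 and 321, every entry has at most one larger
   entry to its left, so the last entry is the largest or the second largest
   value. Deleting it is a bijection onto the avoiders of size one less; adding
   the largest value preserves the number of big descents, and adding the second
   largest value creates one exactly when the word ends with the two largest
   values in decreasing order. This yields
   a_(n+3) = 2 a_(n+2) - (1 - t) a_n for the coefficients of the series. *)

Require Import Defs.
From mathcomp Require Import all_boot all_order all_algebra all_fingroup.
From mathcomp Require Import zify ring.

Set Implicit Arguments.
Unset Strict Implicit.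
Unset Printing Implicit Defensive.

Import GRing.Theory.
Local Open Scope ring_scope.

(** * Coefficients of sums and products of power series *)

Section FpsCoef.
Variable R : comNzRingType.
Implicit Types f g : fps R.

Lemma fcoefD f g n : fcoef (f + g) n = fcoef f n + fcoef g n.
Proof. by []. Qed.

Lemma fcoefN f n : fcoef (- f) n = - fcoef f n.
Proof. by []. Qed.

Lemma fcoefCM c f n : fcoef (fpsC c * f) n = c * fcoef f n.
Proof.
rewrite fcoefM big_ord_recl /= subn0 big1 ?addr0 // => i _.
by rewrite mul0r.
Qed.

Lemma fcoefXM f n : fcoef (fpsX R * f) n = if n is m.+1 then fcoef f m else 0.
Proof.
rewrite fcoefM; case: n => [|n]; first by rewrite big_ord1 mul0r.
rewrite big_ord_recl mul0r add0r big_ord_recl mul1r lift0 subSS subn0.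
by rewrite big1 ?addr0 // => i _; rewrite mul0r.
Qed.

End FpsCoef.

Local Notation ps := ([:: [:: 2; 3; 1]; [:: 3; 2; 1]]%N).

(** * Pattern avoidance and big descents under appending a last entry *)

Section Insertion.
Local Open Scope nat_scope.

Definition left_larger_unique n (s : 'S_n) : Prop :=
  forall i i' k : 'I_n, i < k -> i' < k -> s k < s i -> s k < s i' -> i = i'.

Lemma contains3P n (s : 'S_n) (p0 p1 p2 : nat) :
  reflect (exists a b c : 'I_n, [/\ a < b, b < c,
      (s a < s b) = (p0 < p1) /\ (s b < s a) = (p1 < p0),
      (s a < s c) = (p0 < p2) /\ (s c < s a) = (p2 < p0) &
      (s b < s c) = (p1 < p2) /\ (s c < s b) = (p2 < p1)])
   (contains s [:: p0; p1; p2]).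
Proof.
apply: (iffP existsP) =>
  [[f /forallP fP]|[a [b [c [ab bc [h1 h2] [h3 h4] [h5 h6]]]]]].
  have P (i j : 'I_3) : (i < j -> f i < f j) /\
      (s (f i) < s (f j)) = (nth 0 [:: p0; p1; p2] i < nth 0 [:: p0; p1; p2] j).
    by have /forallP/(_ j)/andP[/implyP ? /eqP ?] := fP i.
  pose i0 : 'I_3 := @Ordinal 3 0 isT.
  pose i1 : 'I_3 := @Ordinal 3 1 isT.
  pose i2 : 'I_3 := @Ordinal 3 2 isT.
  exists (f i0), (f i1), (f i2); rewrite !(P _ _).2.
  by split=> //; [apply: (P i0 i1).1 | apply: (P i1 i2).1].
exists [ffun i : 'I_3 => nth a [:: a; b; c] i].
apply/forallP => -[[|[|[|//]]] ?]; apply/forallP => -[[|[|[|//]]] ?];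
  by rewrite !ffunE /= ?ltnn ?(h1, h2, h3, h4, h5, h6) ?eqxx ?ab ?bc
             ?(ltn_trans ab bc).
Qed.

(** Both patterns are two entries followed by a smaller one, and they cover the two possible orders
    of the first two entries. *)
Lemma avoidersP n (s : 'S_n) :
  reflect (left_larger_unique s) (s \in avoiders n ps).
Proof.
rewrite inE /= andbT; apply: (iffP andP) => [[/contains3P n1 /contains3P n2]|av].
  have lt (i i' k : 'I_n) : i < i' -> i' < k -> s k < s i -> s k < s i' -> False.
    move=> ii' i'k ki ki'.
    have ne : s i != s i' :> nat.
      by apply: contraTneq ii' => /val_inj/perm_inj ->; rewrite ltnn.
    have [si|si] := ltnP (s i) (s i').
      by apply: n1; exists i, i', k; split=> //; split; lia.
    by apply: n2; exists i, i', k; split=> //; split; lia.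
  move=> i i' k ik i'k ki ki'; apply: val_inj.
  by case: (ltngtP i i') => // [/lt|/lt] /(_ k) h; case: h.
by split; apply/contains3P => -[a [b [c [ab bc [h1 h2] [h3 h4] [h5 h6]]]]];
  have e : a = b by [apply: (av _ _ c) => //; lia]; rewrite e ltnn in ab.
Qed.

Lemma avoiders_lift n (s : 'S_n) (j : 'I_n.+1) :
  (lift_perm ord_max j s \in avoiders n.+1 ps) =
    (s \in avoiders n ps) && (n <= j.+1).
Proof.
set u := lift_perm _ _ _.
have uM : u ord_max = j by rewrite /u lift_perm_id.
have uL i : u (lift ord_max i) = lift j (s i) by rewrite /u lift_perm_lift.
apply/avoidersP/andP => [av|[/avoidersP av nj]].
  split.
    apply/avoidersP => i i' k ik i'k ki ki'.
    apply: (@lift_inj _ ord_max); apply: (av _ _ (lift ord_max k)).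
    - by rewrite !lift_max.
    - by rewrite !lift_max.
    - by rewrite !uL /= /bump; lia.
    - by rewrite !uL /= /bump; lia.
  (* Otherwise the values [n.-1] and [n] both exceed the last entry [j], so both stand to its left
     and uniqueness would identify them. *)
  rewrite leqNgt; apply/negP => jn.
  have n1 : n.-1 < n.+1 by lia.
  have pos (v : 'I_n.+1) : j < v -> (u^-1)%g v < n.
    move=> jv; have := ltn_ord ((u^-1)%g v); rewrite ltnS leq_eqVlt.
    case/orP=> // /eqP e; have eM : (u^-1)%g v = ord_max by apply: val_inj.
    by move: jv; rewrite -uM -eM permKV ltnn.
  have /perm_inj /(congr1 val) /= : (u^-1)%g (Ordinal n1) = (u^-1)%g ord_max.
    apply: (av _ _ ord_max); rewrite /= ?permKV ?uM ?pos //=; lia.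
  lia.
move=> i i' k.
(* At the last position the only value that can exceed [j] is the maximum; the other positions
   inherit the property from [s]. *)
have [k' ->|->] := unliftP ord_max k; last first.
  have top (v : 'I_n.+1) : j < v -> v = ord_max.
    by move=> jv; apply: val_inj => /=; have := ltn_ord v; lia.
  by rewrite uM => _ _ /top ui /top ui'; apply: (@perm_inj _ u); rewrite ui ui'.
have [i1 ->|->] := unliftP ord_max i; last first.
  by rewrite lift_max ltnNge /= ltnW.
have [i2 ->|->] := unliftP ord_max i'; last first.
  by rewrite !lift_max => _; rewrite ltnNge /= ltnW.
rewrite !lift_max !uL /= /bump => ik i'k ki ki'.
by congr lift; apply: (av _ _ k') => //; lia.
Qed.

Definition word n (s : 'S_n) : seq nat := [seq val (s i) | i <- enum 'I_n].

Lemma size_word n (s : 'S_n) : size (word s) = n.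
Proof. by rewrite size_map size_enum_ord. Qed.

Lemma nth_word n (s : 'S_n) (i : 'I_n) : nth 0 (word s) i = s i.
Proof. by rewrite (nth_map i) ?size_enum_ord // nth_ord_enum. Qed.

Lemma word_lt n (s : 'S_n) k : k < n -> nth 0 (word s) k < n.
Proof. by move=> kn; rewrite (nth_word s (Ordinal kn)). Qed.

(** With words as lists of naturals, appending a value is an [rcons], after [bump j] has raised the
    old values that are at least [j]. *)
Lemma word_lift n (s : 'S_n) (j : 'I_n.+1) :
  word (lift_perm ord_max j s) = rcons (map (bump j) (word s)) j.
Proof.
rewrite /word enum_ordSr map_rcons lift_perm_id -!map_comp; congr rcons.
apply: eq_map => i /=.
have -> : widen_ord (leqnSn n) i = lift ord_max i.
  by apply/esym/val_inj/lift_max.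
by rewrite lift_perm_lift.
Qed.

Definition word_bdes (w : seq nat) : nat :=
  \sum_(k < (size w).-1) (nth 0 w k.+1 + 1 < nth 0 w k).

Lemma big_descentE n (s : 'S_n) (k : 'I_n) :
  big_descent s k =
    (k.+1 < n) && (nth 0 (word s) k.+1 + 1 < nth 0 (word s) k).
Proof.
apply/existsP/andP => [[l /andP[/eqP lk]]|[kn]].
  by rewrite -lk !nth_word.
by exists (Ordinal kn); rewrite eqxx -!nth_word.
Qed.

Lemma bdes_word n (s : 'S_n) : bdes s = word_bdes (word s).
Proof.
rewrite /bdes /word_bdes size_word -sum1dep_card big_mkcond.
case: n s => [|n] s; first by rewrite !big_ord0.
(* The last position has no successor, so only the [n] adjacent pairs remain. *)
rewrite big_ord_recr big_descentE ltnn /= addn0.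
apply: eq_bigr => k _; rewrite big_descentE /= ltnS ltn_ord /=.
by case: ifP.
Qed.

Lemma word_bdes_rcons w b :
  word_bdes (rcons w b) = word_bdes w + ((0 < size w) && (b + 1 < last 0 w)).
Proof.
case: w => [|a w]; first by rewrite /word_bdes !big_ord0.
rewrite /word_bdes size_rcons big_ord_recr /= -rcons_cons !nth_rcons /=.
rewrite ltnSn ltnn eqxx -last_nth /=; congr (_ + _).
apply: eq_bigr => -[i iw] _.
by rewrite -rcons_cons !nth_rcons /= ltnS iw (ltnW iw).
Qed.

Definition append_max n (s : 'S_n) : 'S_n.+1 := lift_perm ord_max ord_max s.

(** The appended value is [n], the second largest of the values from 0 to [n.+1]. *)
Definition append_second n (s : 'S_n.+1) : 'S_n.+2 :=
  lift_perm ord_max (widen_ord (leqnSn n.+1) ord_max) s.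

Lemma word_append_max n (s : 'S_n) : word (append_max s) = rcons (word s) n.
Proof.
rewrite word_lift; congr rcons; rewrite -[RHS]map_id -!map_comp.
by apply: eq_map => i /=; rewrite /bump; have := ltn_ord (s i); lia.
Qed.

Lemma word_append_second n (s : 'S_n.+1) :
  word (append_second s) = rcons (map (bump n) (word s)) n.
Proof. exact: word_lift. Qed.

Lemma last_word n (s : 'S_n.+1) : last 0 (word s) = s ord_max.
Proof. by rewrite -nth_last size_word -nth_word. Qed.

Lemma last_word_le n (s : 'S_n) : last 0 (word s) <= n.
Proof.
case: n s => [|n] s; first by rewrite (size0nil (size_word s)).
by rewrite last_word ltnW.
Qed.

Lemma bdes_append_max n (s : 'S_n) : bdes (append_max s) = bdes s.
Proof.
rewrite !bdes_word word_append_max word_bdes_rcons.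
by have := last_word_le s; lia.
Qed.

(** The new word is that of [s] followed by [n.+1] and [n]: an ascent or nothing, then a descent by
    exactly one, which is not big. *)
Lemma bdes_append_second_max n (s : 'S_n) :
  bdes (append_second (append_max s)) = bdes s.
Proof.
rewrite -[RHS]bdes_append_max !bdes_word word_append_second word_append_max.
rewrite map_rcons [map _ _](_ : _ = word s) /bump ?leqnn.
  by rewrite !word_bdes_rcons last_rcons; have := last_word_le s; lia.
rewrite -[RHS]map_id -!map_comp.
by apply: eq_map => i /=; have := ltn_ord (s i); lia.
Qed.

(* On the positions of s, the two words differ only at the maximum n of s, which
   becomes n+2 instead of n+1. Inside s it is followed by a value below n, so it
   is a big descent in both words; only a final n, now n+2 followed by n, gives a
   new one. *)
Lemma bdes_append_second2 n (s : 'S_n.+1) :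
  bdes (append_second (append_second s)) =
    bdes (append_second s) + (s ord_max == ord_max).
Proof.
rewrite !bdes_word !word_append_second map_rcons !word_bdes_rcons !last_rcons.
rewrite -map_comp.
have sizeE (f : nat -> nat) : size (map f (word s)) = n.+1.
  by rewrite size_map size_word.
have lastE (f : nat -> nat) : last 0 (map f (word s)) = f (s ord_max).
  by rewrite -nth_last sizeE (nth_map 0) ?size_word // -nth_word.
rewrite size_rcons !sizeE !lastE -val_eqE /=.
have -> : word_bdes (map (bump n.+1 \o bump n) (word s)) =
          word_bdes (map (bump n) (word s)).
  rewrite /word_bdes !sizeE; apply: eq_bigr => k _.
  have kn : k.+1 < n.+1 by rewrite ltnS ltn_ord.
  rewrite !(nth_map 0) ?size_word ?(ltnW kn) //=.
  have := word_lt s kn; have := word_lt s (ltnW kn); rewrite /bump; lia.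
have := ltn_ord (s ord_max); rewrite /bump /=; lia.
Qed.

End Insertion.

(** * Summation over avoiders by their last entry *)

Section Recurrence.
Variable R : comNzRingType.

(** Injectivity suffices, because both sides have (n+1) n! = (n+1)! elements. *)
Lemma lift_perm_bij n (i : 'I_n.+1) :
  bijective (fun p : 'I_n.+1 * 'S_n => lift_perm i p.1 p.2).
Proof.
apply: inj_card_bij => [[j s] [j' s'] /= /permP eq_u|].
  have := eq_u i; rewrite !lift_perm_id => eq_j; rewrite -{}eq_j in eq_u *.
  congr pair; apply/permP => k; have := eq_u (lift i k).
  by rewrite !lift_perm_lift => /lift_inj.
by rewrite card_prod !card_Sn card_ord factS.
Qed.

Lemma sum_avoiders_recl n (F : 'S_n.+1 -> R) :
  \sum_(s in avoiders n.+1 ps) F s =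
    \sum_(j < n.+1 | (n <= j.+1)%N) \sum_(s in avoiders n ps)
      F (lift_perm ord_max j s).
Proof.
rewrite (reindex _ (onW_bij _ (lift_perm_bij ord_max))) pair_big /=.
by apply: eq_bigl => -[j s]; rewrite avoiders_lift andbC.
Qed.

Lemma sum_avoiders0 (F : 'S_0 -> R) :
  \sum_(s in avoiders 0 ps) F s = F 1%g.
Proof.
have all1 (s : 'S_0) : s = 1%g by apply/permP => -[].
rewrite (big_pred1 1%g) // => s; rewrite /= (all1 s) eqxx.
by apply/avoidersP => -[].
Qed.

Lemma sum_avoiders1 (F : 'S_1 -> R) :
  \sum_(s in avoiders 1 ps) F s = \sum_(s in avoiders 0 ps) F (append_max s).
Proof.
by rewrite sum_avoiders_recl big_mkcond big_ord_recr big_ord0 /= add0r.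
Qed.

Lemma sum_avoidersSS n (F : 'S_n.+2 -> R) :
  \sum_(s in avoiders n.+2 ps) F s =
    \sum_(s in avoiders n.+1 ps) F (append_max s)
      + \sum_(s in avoiders n.+1 ps) F (append_second s).
Proof.
rewrite sum_avoiders_recl big_mkcond !big_ord_recr /= leqnn leqnSn.
rewrite [X in X + _ + _]big1 => [|i _]; first by rewrite add0r addrC.
by rewrite ltnS leqNgt ltn_ord.
Qed.

(** This isolates the permutations for which [bdes_append_second2] yields an extra big descent. *)
Lemma sum_avoiders_max n (F : 'S_n.+1 -> R) :
  \sum_(s in avoiders n.+1 ps | s ord_max == ord_max) F s =
    \sum_(s in avoiders n ps) F (append_max s).
Proof.
rewrite big_mkcondr sum_avoiders_recl (bigD1 ord_max) /= ?leqnSn //.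
rewrite [X in _ + X]big1 ?addr0 => [|j /andP[_ /negPf jM]].
  by apply: eq_bigr => s _; rewrite lift_perm_id eqxx.
by rewrite big1 // => s _; rewrite lift_perm_id jM.
Qed.

End Recurrence.

(** * The coefficient recurrence and the closed form *)

Lemma fcoef_bdes_gf_rec n :
  let a := fcoef (bdes_gf ps) in
  a n.+3 = a n.+2 *+ 2 - (1 - 'X) * a n.
Proof.
move=> a.
(* The avoiders of size [m.+2] ending in the second largest value contribute [b m]; eliminating [b]
   between [aSS] and [bS] gives the recurrence. *)
pose b m : {poly int} :=
  \sum_(s in avoiders m.+1 ps) 'X^(bdes (append_second s)).
have aSS m : a m.+2 = a m.+1 + b m.
  rewrite /a /= sum_avoidersSS; congr (_ + _).
  by apply: eq_bigr => s _; rewrite bdes_append_max.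
have bS : b n.+1 = a n.+1 + (b n - (1 - 'X) * a n).
  rewrite /b sum_avoidersSS; congr (_ + _).
    by apply: eq_bigr => s _; rewrite bdes_append_second_max.
  (* Each [s] ending in its maximum carries an extra factor ['X], which changes its term in [b n] by
     the factor ['X] instead of 1; these terms of [b n] add up to [a n]. *)
  have -> : a n = \sum_(s in avoiders n.+1 ps | s ord_max == ord_max)
                     'X^(bdes (append_second s)).
    rewrite sum_avoiders_max.
    by apply: eq_bigr => s _; rewrite bdes_append_second_max.
  rewrite big_mkcondr /= mulr_sumr -sumrB; apply: eq_bigr => s _.
  rewrite bdes_append_second2 exprD.
  by case: ifP => _ /=; ring.
by rewrite aSS bS aSS; ring.
Qed.

Lemma fcoef_bdes_gf_init :
  let a := fcoef (bdes_gf ps) in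
  [/\ a 0%N = 1, a 1%N = 1 & a 2%N = 2%:R].
Proof.
have bdes0 : bdes (1%g : 'S_0) = 0%N.
  by rewrite bdes_word /word_bdes size_word big_ord0.
split; rewrite /= ?sum_avoidersSS ?sum_avoiders1 sum_avoiders0;
  by rewrite ?sum_avoiders1 ?sum_avoiders0 ?bdes_append_second_max
             ?bdes_append_max ?bdes0.
Qed.

Theorem theorem3p10 :
  let t : fps {poly int} := fpsC 'X in
  let x : fps {poly int} := fpsX {poly int} in
  bdes_gf [:: [:: 2; 3; 1]%N; [:: 3; 2; 1]%N] =
    (1 - x) / (1 - 2%:R * x + (1 - t) * x ^+ 3).
Proof.
move=> t x; set D := (X in _ / X).
(* Nested products by [x] let [fcoefXM] read each coefficient as a shift. *)
have DB f : D * f =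
    f - (x * f + x * f) + x * (x * (x * f)) - t * (x * (x * (x * f))).
  by rewrite /D; ring.
(* The constant coefficient of [D] is 1, as [DB] at [f = 1] shows. *)
have UD : D \is a GRing.unit.
  rewrite fps_unitE -[D]mulr1 DB.
  rewrite !(fcoefD, fcoefN) fcoefCM !fcoefXM fcoef1 /=.
  by rewrite !(addr0, oppr0, mulr0) unitr1.
(* After clearing the denominator, degrees 0, 1 and 2 are the initial values and every higher degree
   is the recurrence. *)
apply: (mulrI UD); rewrite mulrCA divrr // mulr1 DB; apply/fpsP => n.
rewrite !(fcoefD, fcoefN) fcoefCM !fcoefXM fcoef1.
have [a0 a1 a2] := fcoef_bdes_gf_init.
case: n => [|[|[|n]]];
  by rewrite ?fcoefXM ?fcoef_bdes_gf_rec ?(a0, a1, a2) /=; ring.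
Qed.
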